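(* Consider the algorithm $\mathrm{Alg}(p_1,\alpha_1,d_1,p_2,\alpha_2,d_2)$ described in the context, run with the parameters $p_1^{*}=2.62666582851$, $\alpha_1^{*}=2\pi/9$, $d_1^{*}=0.490011696287$, $p_2^{*}=2.97374843355$, $\alpha_2^{*}=0.05523991\pi$, $d_2^{*}=0.1670474016$. For every position of the exit on the boundary of the closed unit disk, the evacuation time of this algorithm is at most $5.6234$.
   Context: Evacuation problem: two robots $R_1,R_2$ start at the center $O=(0,0)$ of the closed unit disk and move at unit speed. An exit is located at an unknown point of the boundary circle. A robot learns the exit location only when it reaches that point, and the robots can exchange information (instantaneously) only when they are at the same point. The evacuation time for a given exit position is the time until both robots have reached the exit. Algorithm $\mathrm{Alg}(p_1,\alpha_1,d_1,p_2,\alpha_2,d_2)$, with $0<p_1<p_2<\pi$, $d_1,d_2>0$. Let $I=(0,1)$ and $I'=(0,-1)$. Until the exit is found, the robots move as follows. Both robots move straight from $O$ to $I$. Then $R_1$ moves counterclockwise and $R_2$ clockwise along the circle. When each has covered arc length $p_1$, $R_1$ is at $C_1=(-\sin p_1,\cos p_1)$ and $R_2$ at $C_1'=(\sin p_1,\cos p_1)$; there they perform a first cut: $R_1$ moves straight from $C_1$ in direction $(\cos\alpha_1,\sin\alpha_1)$ for distance $d_1$ (reaching $P_1$) and $R_2$ moves straight from $C_1'$ in direction $(-\cos\alpha_1,\sin\alpha_1)$ for distance $d_1$ (reaching $P_1'$); then each returns along the same segment to $C_1$, resp. $C_1'$, and continues along the circle in its previous rotational direction. When each has covered total arc length $p_2$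 along the circle, $R_1$ is at $C_2=(-\sin p_2,\cos p_2)$ and $R_2$ at $C_2'=(\sin p_2,\cos p_2)$; they perform a second cut in the same way with angle $\alpha_2$ and length $d_2$ (directions $(\cos\alpha_2,\sin\alpha_2)$ for $R_1$ and $(-\cos\alpha_2,\sin\alpha_2)$ for $R_2$), return to $C_2$, resp. $C_2'$, and continue along the circle. Meeting protocol: if a robot finds the exit at point $E$ at time $t_0$, it computes the smallest $t\ge 0$ such that the other robot, following its trajectory above, is at time $t_0+t$ at a point $M$ with $|EM|=t$; it moves straight to $M$, meets the other robot there at time $t_0+t$, and both move straight back to $E$, so the evacuation time is $t_0+2t$. *)

(* Defs.v *)
From Stdlib Require Import Reals.
Open Scope R_scope.

Definition point : Type := (R * R)%type.

Definition edist (A B : point) : R := dist_euc (fst A) (snd A) (fst B) (snd B).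

Definition on_unit_circle (E : point) : Prop := fst E ^ 2 + snd E ^ 2 = 1.

Definition along (A B : point) (k : R) : point :=
  (fst A + k * (fst B - fst A), snd A + k * (snd B - snd A)).

Inductive robot : Type := Rob1 | Rob2.

Definition other (r : robot) : robot :=
  match r with Rob1 => Rob2 | Rob2 => Rob1 end.

(* Rob1 sweeps the left half of the circle, Rob2 the right half. *)
Definition side (r : robot) : R :=
  match r with Rob1 => -1 | Rob2 => 1 end.

(* Position at arc length s from I = (0, 1), counterclockwise for Rob1 and
   clockwise for Rob2. *)
Definition circle_pos (r : robot) (s : R) : point := (side r * sin s, cos s).

(* Position after time u, 0 <= u <= 2 d, of the excursion that leaves the circle
   at arc length p in direction (cos a, sin a) (Rob1) or (- cos a, sin a) (Rob2),
   goes to distance d, and comes back along the same segment. *)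
Definition cut_pos (r : robot) (p a d u : R) : point :=
  let l := if Rle_dec u d then u else 2 * d - u in
  (fst (circle_pos r p) - side r * (l * cos a),
   snd (circle_pos r p) + l * sin a).

Record params : Type := Params {
  p1 : R; alpha1 : R; d1 : R;
  p2 : R; alpha2 : R; d2 : R }.

(* Position at time t >= 0 of a robot that has not learned where the exit is. *)
Definition trajectory (A : params) (r : robot) (t : R) : point :=
  if Rle_dec t 1 then (0, t)
  else if Rle_dec t (1 + p1 A) then circle_pos r (t - 1)
  else if Rle_dec t (1 + p1 A + 2 * d1 A) then
    cut_pos r (p1 A) (alpha1 A) (d1 A) (t - (1 + p1 A))
  else if Rle_dec t (1 + p2 A + 2 * d1 A) then
    circle_pos r (t - 1 - 2 * d1 A)
  else if Rle_dec t (1 + p2 A + 2 * d1 A + 2 * d2 A) then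
    cut_pos r (p2 A) (alpha2 A) (d2 A) (t - (1 + p2 A + 2 * d1 A))
  else circle_pos r (t - 1 - 2 * d1 A - 2 * d2 A).

Definition is_least (S : R -> Prop) (m : R) : Prop :=
  S m /\ forall x, S x -> m <= x.

(* Robot r is the first (possibly jointly with the other one) to reach E,
   and does so at time t0. *)
Definition finds_exit (A : params) (E : point) (r : robot) (t0 : R) : Prop :=
  trajectory A r t0 = E /\
  is_least (fun s => 0 <= s /\ exists r', trajectory A r' s = E) t0.

(* t is the delay that the finder r computes at time t0. *)
Definition meeting_delay (A : params) (E : point) (r : robot) (t0 t : R) : Prop :=
  is_least (fun u => 0 <= u /\ edist E (trajectory A (other r) (t0 + u)) = u) t.

(* Actual position at time s of robot q when robot r finds the exit E at time t0
   and the meeting takes place at time t0 + t, at the point M. Since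
   edist E M = t, the segments below are traversed at unit speed; if t = 0
   then M = E and the junk value of the division by t is harmless. *)
Definition run (A : params) (E : point) (r : robot) (t0 t : R)
    (q : robot) (s : R) : point :=
  let M := trajectory A (other r) (t0 + t) in
  let back := if Rle_dec s (t0 + 2 * t) then along M E ((s - (t0 + t)) / t) else E in
  match q, r with
  | Rob1, Rob1 | Rob2, Rob2 =>
      if Rle_dec s t0 then trajectory A q s
      else if Rle_dec s (t0 + t) then along E M ((s - t0) / t)
      else back
  | Rob1, Rob2 | Rob2, Rob1 =>
      if Rle_dec s (t0 + t) then trajectory A q s else back
  end.

(* T is the first time by which both robots have reached the exit E; this is
   t0 + 2 t for the discovery time t0 and the meeting delay t. *)
Definition evacuation_time (A : params) (E : point) (T : R) : Prop :=
  exists r t0 t,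
    finds_exit A E r t0 /\ meeting_delay A E r t0 t /\
    is_least (fun T' => forall q, exists s, 0 <= s <= T' /\ run A E r t0 t q s = E) T.

Definition star_params : params :=
  {| p1 := 2.62666582851; alpha1 := 2 * PI / 9;     d1 := 0.490011696287;
     p2 := 2.97374843355; alpha2 := 0.05523991 * PI; d2 := 0.1670474016 |}.

(* Main.v *)
From Stdlib Require Import Reals Lra FunctionalExtensionality.
Require Import Defs.
Open Scope R_scope.

(** The distance between the exit and the other robot varies continuously, so the
    finder, who discovers the exit at time t0, meets the other robot after a delay
    of at most u as soon as the other robot is within distance u of the exit at
    time t0 + u.  Evacuation by time 5.6234 therefore follows from this condition
    for the single value u = (5.6234 - t0) / 2, which turns the theorem into one
    inequality in the arc length s of the exit.  Writing out the squared distance,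
    this is a trigonometric inequality on each piece of the trajectory.  It is
    nearly an equality at the breakpoints, so on each piece sin and cos are
    expanded by Taylor polynomials around the critical end, and what remains is a
    polynomial inequality with explicitly enclosed coefficients. *)

(** * Decimal enclosures of sine, cosine and pi *)

Ltac expand_taylor H :=
  unfold cos_approx, cos_term, sin_approx, sin_term in H;
  cbn -[INR pow Factorial.fact] in H;
  rewrite ?fact_simpl, ?mult_INR, ?S_INR in H; simpl INR in H.

Lemma cos_taylor (a : R) : -2 <= a <= 2 ->
  1 - a^2/2 + a^4/24 - a^6/720 + a^8/40320 - a^10/3628800 <= cos a
  <= 1 - a^2/2 + a^4/24 - a^6/720 + a^8/40320 - a^10/3628800 + a^12/479001600.
Proof.
  intros [h1 h2]. pose proof (pre_cos_bound a 2 h1 h2) as H.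
  expand_taylor H. lra.
Qed.

Lemma sin_taylor (a : R) : 0 <= a <= 4 ->
  a - a^3/6 + a^5/120 - a^7/5040 + a^9/362880 - a^11/39916800 <= sin a
  <= a - a^3/6 + a^5/120 - a^7/5040 + a^9/362880 - a^11/39916800
     + a^13/6227020800.
Proof.
  intros [h1 h2]. pose proof (pre_sin_bound a 2 h1 h2) as H.
  expand_taylor H. lra.
Qed.

Lemma cos_taylor_low (a : R) : -2 <= a <= 2 ->
  1 - a^2/2 <= cos a <= 1 - a^2/2 + a^4/24.
Proof.
  intros [h1 h2]. pose proof (pre_cos_bound a 0 h1 h2) as H.
  expand_taylor H. lra.
Qed.

Lemma cos_taylor_mid (a : R) : -2 <= a <= 2 ->
  1 - a^2/2 + a^4/24 - a^6/720 <= cos a.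
Proof.
  intros [h1 h2]. pose proof (pre_cos_bound a 1 h1 h2) as H.
  expand_taylor H. lra.
Qed.

Lemma sin_taylor_low (a : R) : 0 <= a <= 4 ->
  a - a^3/6 <= sin a <= a - a^3/6 + a^5/120.
Proof.
  intros [h1 h2]. pose proof (pre_sin_bound a 0 h1 h2) as H.
  expand_taylor H. lra.
Qed.

(** Cosine changes sign at [PI / 2], so its strict sign at half of each endpoint, read off from
    Taylor bounds, places that endpoint relative to [PI]. *)
Lemma PI_enclosure : 3.1415926534 < PI < 3.1415926536.
Proof.
  pose proof PI2_3_2 as h3. pose proof PI_4 as h4. split.
  - destruct (Rle_lt_dec PI 3.1415926534) as [h|h]; [exfalso|exact h].
    assert (H0 : cos 1.5707963267 <= 0) by (apply cos_le_0; lra).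
    pose proof (pre_cos_bound 1.5707963267 4 ltac:(lra) ltac:(lra)) as H.
    expand_taylor H. lra.
  - destruct (Rle_lt_dec 3.1415926536 PI) as [h|h]; [exfalso|exact h].
    assert (H0 : 0 <= cos 1.5707963268) by (apply cos_ge_0; lra).
    pose proof (pre_cos_bound 1.5707963268 4 ltac:(lra) ltac:(lra)) as H.
    expand_taylor H. lra.
Qed.

Lemma Rabs_le_bounds (a b : R) : Rabs a <= b -> - b <= a <= b.
Proof. unfold Rabs. destruct (Rcase_abs a); lra. Qed.

Lemma Rabs_sin_le (x : R) : Rabs (sin x) <= Rabs x.
Proof.
  assert (H : forall y, 0 < y -> Rabs (sin y) <= y).
  { intros y hy. apply Rabs_le. pose proof (sin_lt_x y hy).
    pose proof (SIN_bound y). pose proof PI_enclosure.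
    destruct (Rle_lt_dec y PI) as [h|h]; [|lra].
    pose proof (sin_ge_0 y ltac:(lra) h). lra. }
  destruct (Rtotal_order x 0) as [h|[->|h]].
  - rewrite <- Rabs_Ropp, <- sin_neg, (Rabs_left x h). apply H. lra.
  - rewrite sin_0. lra.
  - rewrite (Rabs_right x) by lra. now apply H.
Qed.

Lemma cos_lipschitz (x y : R) : Rabs (cos x - cos y) <= Rabs (x - y).
Proof.
  rewrite form2, !Rabs_mult, (Rabs_left (-2)) by lra.
  pose proof (Rabs_sin_le ((x - y) / 2)) as H1.
  unfold Rdiv in H1 at 2. rewrite Rabs_mult, (Rabs_right (/ 2)) in H1 by lra.
  assert (H2 : Rabs (sin ((x + y) / 2)) <= 1).
  { apply Rabs_le. pose proof (SIN_bound ((x + y) / 2)). lra. }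
  pose proof (Rabs_pos (sin ((x - y) / 2))).
  pose proof (Rabs_pos (sin ((x + y) / 2))). nra.
Qed.

(** The Taylor polynomial is evaluated at a decimal [q]; the Lipschitz bound carries the result to a
    real [x] involving [PI], at the cost of the error [e]. *)
Lemma cos_enclosure (q e x : R) : -2 <= q <= 2 -> q - e <= x <= q + e ->
  1 - q^2/2 + q^4/24 - q^6/720 + q^8/40320 - q^10/3628800 - e <= cos x
  <= 1 - q^2/2 + q^4/24 - q^6/720 + q^8/40320 - q^10/3628800 + q^12/479001600
     + e.
Proof.
  intros hq hx. pose proof (cos_taylor q hq).
  assert (hd : Rabs (x - q) <= e) by (apply Rabs_le; lra).
  destruct (Rabs_le_bounds _ _ (Rle_trans _ _ _ (cos_lipschitz x q) hd)). lra.
Qed.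

Lemma sin_enclosure (q e x : R) : 0 <= q <= 4 -> q - e <= x <= q + e ->
  q - q^3/6 + q^5/120 - q^7/5040 + q^9/362880 - q^11/39916800 - e <= sin x
  <= q - q^3/6 + q^5/120 - q^7/5040 + q^9/362880 - q^11/39916800
     + q^13/6227020800 + e.
Proof.
  intros hq hx. pose proof (sin_taylor q hq).
  (* Sine is a shifted cosine, so the Lipschitz bound for cosine suffices. *)
  assert (hd : Rabs (PI / 2 - x - (PI / 2 - q)) <= e) by (apply Rabs_le; lra).
  pose proof (Rle_trans _ _ _ (cos_lipschitz (PI / 2 - x) (PI / 2 - q)) hd) as H1.
  rewrite !cos_shift in H1. destruct (Rabs_le_bounds _ _ H1). lra.
Qed.

Lemma cos_2PI_minus (x : R) : cos (2 * PI - x) = cos x.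
Proof. rewrite cos_minus, cos_2PI, sin_2PI. ring. Qed.

(** The radius [1e-9] absorbs both the rounding of the ten-digit [q] and the uncertainty about [PI],
    whose enclosure must be in the context. *)
Ltac enclose q :=
  match goal with
  | |- _ <= cos ?x <= _ =>
      assert (q - 1e-9 <= x <= q + 1e-9) as hx by lra;
      pose proof (cos_enclosure q 1e-9 x ltac:(lra) hx); lra
  | |- _ <= sin ?x <= _ =>
      assert (q - 1e-9 <= x <= q + 1e-9) as hx by lra;
      pose proof (sin_enclosure q 1e-9 x ltac:(lra) hx); lra
  end.

(** * The inequality on each piece of the trajectory *)

(* In the next eight lemmas the exit at arc length [s] is found at time [t0], the
   right-hand side is the square of [u := (5.6234 - t0) / 2], and the left-hand side
   is the squared distance from the exit to the other robot at time [t0 + u].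
   Where [h] occurs, it is the distance from [s] to the arc length at which the
   inequality is nearly tight.  That is [p1] for [second_cut_outbound]; otherwise
   it is the arc length for which, at time [t0 + u], the other robot starts or
   ends a cut: 2 (1 + p1) - 6.6234 = 0.62993165702,
   2 (1 + p1 + 2 d1) - 6.6234 = 2.589978442168 and
   2 (1 + p2 + d1 + 2 d2) - 6.6234 = 2.972309866074 (margin 4e-7). *)
Lemma first_cut_outbound (h : R) : 0 <= h <= 0.981 ->
  2 - 2 * cos (2.62666582851 + (0.62993165702 + h)) + (h / 2) ^ 2
    - 2 * (h / 2) * (sin (2.62666582851 - 2 * PI / 9)
                     + sin (0.62993165702 + h + 2 * PI / 9))
  <= (1.99673417149 - h / 2) ^ 2.
Proof.
  intros hh. pose proof PI_enclosure as hpi.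
  (* Here and in the similar proofs below, [x], [y] and [z] are the angles at [h = 0], up to a
     reflection or a shift by a multiple of [PI]. The addition formulas separate them from [h]. *)
  remember (2.62666582851 + 0.62993165702 - PI) as x eqn:Ex.
  remember (0.62993165702 + 2 * PI / 9) as y eqn:Ey.
  remember (2.62666582851 - 2 * PI / 9) as z eqn:Ez.
  assert (0.993394 <= cos x <= 0.993395) by enclose 0.1150048319.
  assert (0.114751 <= sin x <= 0.114752) by enclose 0.1150048319.
  assert (0.240356 <= cos y <= 0.240357) by enclose 1.3280633578.
  assert (0.970683 <= sin y <= 0.970685) by enclose 1.3280633578.
  assert (0.93669 <= sin z <= 0.93670) by enclose 1.9285341277.
  replace (2.62666582851 + (0.62993165702 + h)) with (PI + x + h) by lra.
  replace (0.62993165702 + h + 2 * PI / 9) with (y + h) by lra.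
  rewrite (cos_plus (PI + x)), Rtrigo_facts.cos_pi_plus, Rtrigo_facts.sin_pi_plus,
    (sin_plus y).
  clear Ex Ey Ez.
  pose proof (cos_taylor_low h ltac:(lra)).
  pose proof (sin_taylor_low h ltac:(lra)).
  assert (0 <= h ^ 2 <= 0.981 * h) by nra.
  assert (0 <= h ^ 3 <= 0.981 * h ^ 2) by nra.
  assert (0 <= h ^ 4 <= 0.981 * h ^ 3) by nra.
  assert (cos x * cos h <= 0.993395 * (1 - h^2/2 + h^4/24)) by nra.
  assert (0.114751 * (h - h^3/6) <= sin x * sin h) by nra.
  assert (0.970683 * (1 - h^2/2) <= sin y * cos h) by nra.
  assert (0.240356 * (h - h^3/6) <= cos y * sin h) by nra.
  (* The sine bracket is bounded as a whole before it is multiplied by [h >= 0], which leaves a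
     polynomial inequality in [h]. *)
  assert (h * (0.93669 + 0.970683 * (1 - h^2/2) + 0.240356 * (h - h^3/6))
    <= h * (sin z + (sin y * cos h + cos y * sin h)))
    by (apply Rmult_le_compat_l; lra).
  nra.
Qed.

Lemma first_cut_return (h : R) : 0 <= h <= 0.981 ->
  2 - 2 * cos (2.62666582851 + (2.589978442168 - h)) + (h / 2) ^ 2
    - 2 * (h / 2) * (sin (2.62666582851 - 2 * PI / 9)
                     + sin (2.589978442168 - h + 2 * PI / 9))
  <= (1.016710778916 + h / 2) ^ 2.
Proof.
  intros hh. pose proof PI_enclosure as hpi.
  remember (2 * PI - 2.62666582851 - 2.589978442168) as x eqn:Ex.
  remember (2.589978442168 + 2 * PI / 9 - PI) as y eqn:Ey.
  remember (2.62666582851 - 2 * PI / 9) as z eqn:Ez.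
  assert (0.483155 <= cos x <= 0.483156) by enclose 1.0665410365.
  assert (0.875534 <= sin x <= 0.875535) by enclose 1.0665410365.
  assert (0.989285 <= cos y <= 0.989286) by enclose 0.1465174894.
  assert (0.145993 <= sin y <= 0.145994) by enclose 0.1465174894.
  assert (0.93669 <= sin z <= 0.93670) by enclose 1.9285341277.
  replace (2.62666582851 + (2.589978442168 - h)) with (2 * PI - (x + h)) by lra.
  replace (2.589978442168 - h + 2 * PI / 9) with (PI + (y - h)) by lra.
  rewrite cos_2PI_minus, cos_plus, Rtrigo_facts.sin_pi_plus, sin_minus.
  clear Ex Ey Ez.
  pose proof (cos_taylor_low h ltac:(lra)).
  pose proof (cos_taylor_mid h ltac:(lra)).
  pose proof (sin_taylor_low h ltac:(lra)).
  assert (0 <= h ^ 2 <= 0.981 * h) by nra.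
  assert (0 <= h ^ 3 <= 0.981 * h ^ 2) by nra.
  assert (0 <= h ^ 4 <= 0.981 * h ^ 3) by nra.
  assert (0 <= h ^ 5 <= 0.981 * h ^ 4) by nra.
  assert (0 <= h ^ 6 <= 0.981 * h ^ 5) by nra.
  assert (0.483155 * (1 - h^2/2 + h^4/24 - h^6/720) <= cos x * cos h) by nra.
  assert (sin x * sin h <= 0.875535 * (h - h^3/6 + h^5/120)) by nra.
  assert (sin y * cos h <= 0.145994 * (1 - h^2/2 + h^4/24)) by nra.
  assert (0.989285 * (h - h^3/6) <= cos y * sin h) by nra.
  assert (h * (0.93669 - 0.145994 * (1 - h^2/2 + h^4/24) + 0.989285 * (h - h^3/6))
    <= h * (sin z + - (sin y * cos h - cos y * sin h)))
    by (apply Rmult_le_compat_l; lra).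
  nra.
Qed.

Lemma second_cut_outbound (h : R) : 0 <= h <= 0.012 ->
  2 - 2 * cos (2.97374843355 + (2.62666582851 + h)) + (0.161272784418 + h / 2) ^ 2
    - 2 * (0.161272784418 + h / 2) * (sin (2.97374843355 - 0.05523991 * PI)
                     + sin (2.62666582851 + h + 0.05523991 * PI))
  <= (0.508355389458 - h / 2) ^ 2.
Proof.
  intros hh. pose proof PI_enclosure as hpi.
  remember (2 * PI - 2.97374843355 - 2.62666582851) as x eqn:Ex.
  remember (PI - 2.62666582851 - 0.05523991 * PI) as y eqn:Ey.
  remember (PI - 2.97374843355 + 0.05523991 * PI) as z eqn:Ez.
  assert (0.775827 <= cos x <= 0.775828) by enclose 0.6827710451.
  assert (0.630945 <= sin x <= 0.630946) by enclose 0.6827710451.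
  assert (0.942291 <= cos y <= 0.942292) by enclose 0.3413855296.
  assert (0.334792 <= sin y <= 0.334793) by enclose 0.3413855296.
  assert (0.334792 <= sin z <= 0.334793) by enclose 0.3413855155.
  replace (2.97374843355 + (2.62666582851 + h)) with (2 * PI - (x - h)) by lra.
  replace (2.62666582851 + h + 0.05523991 * PI) with (PI - (y - h)) by lra.
  replace (2.97374843355 - 0.05523991 * PI) with (PI - z) by lra.
  rewrite cos_2PI_minus, cos_minus, !sin_PI_x, sin_minus.
  clear Ex Ey Ez.
  pose proof (cos_taylor_low h ltac:(lra)).
  pose proof (sin_taylor_low h ltac:(lra)).
  assert (0 <= h ^ 2 <= 0.012 * h) by nra.
  assert (0 <= h ^ 3 <= 0.012 * h ^ 2) by nra.
  assert (0 <= h ^ 4 <= 0.012 * h ^ 3) by nra.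
  assert (0 <= h ^ 5 <= 0.012 * h ^ 4) by nra.
  assert (0.775827 * (1 - h^2/2) <= cos x * cos h) by nra.
  assert (0.630945 * (h - h^3/6) <= sin x * sin h) by nra.
  assert (0.334792 * (1 - h^2/2) <= sin y * cos h) by nra.
  assert (cos y * sin h <= 0.942292 * h) by nra.
  (* The constant 0.161272784418 is how far the other robot has gone into its second cut at time
     [t0 + u] when the exit lies just past [p1]. *)
  assert ((0.161272784418 + h / 2) * (0.334792 + 0.334792 * (1 - h^2/2) - 0.942292 * h)
    <= (0.161272784418 + h / 2) * (sin z + (sin y * cos h - cos y * sin h)))
    by (apply Rmult_le_compat_l; lra).
  nra.
Qed.

Lemma second_cut_return (h : R) : 0 <= h <= 0.335 ->
  2 - 2 * cos (2.97374843355 + (2.972309866074 - h)) + (h / 2) ^ 2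
    - 2 * (h / 2) * (sin (2.97374843355 - 0.05523991 * PI)
                     + sin (2.972309866074 - h + 0.05523991 * PI))
  <= (0.335533370676 + h / 2) ^ 2.
Proof.
  intros hh. pose proof PI_enclosure as hpi.
  remember (2 * PI - 2.97374843355 - 2.972309866074) as x eqn:Ex.
  remember (2.972309866074 + 0.05523991 * PI - PI) as y eqn:Ey.
  remember (PI - 2.97374843355 + 0.05523991 * PI) as z eqn:Ez.
  (* The lower bound needs its seventh digit: with 0.943708 the margin at [h = 0] would be lost. *)
  assert (0.9437088 <= cos x <= 0.943709) by enclose 0.3371270075.
  assert (0.330777 <= sin x <= 0.330778) by enclose 0.3371270075.
  assert (0.99999 <= cos y <= 0.999991) by enclose 0.0042585079.
  assert (0.004258 <= sin y <= 0.004259) by enclose 0.0042585079.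
  assert (0.334792 <= sin z <= 0.334793) by enclose 0.3413855155.
  replace (2.97374843355 + (2.972309866074 - h)) with (2 * PI - (x + h)) by lra.
  replace (2.972309866074 - h + 0.05523991 * PI) with (PI + (y - h)) by lra.
  replace (2.97374843355 - 0.05523991 * PI) with (PI - z) by lra.
  rewrite cos_2PI_minus, cos_plus, Rtrigo_facts.sin_pi_plus, sin_PI_x, sin_minus.
  clear Ex Ey Ez.
  pose proof (cos_taylor_low h ltac:(lra)).
  pose proof (sin_taylor_low h ltac:(lra)).
  assert (0 <= h ^ 2 <= 0.335 * h) by nra.
  assert (0 <= h ^ 3 <= 0.335 * h ^ 2) by nra.
  assert (0 <= h ^ 4 <= 0.335 * h ^ 3) by nra.
  assert (0 <= h ^ 5 <= 0.335 * h ^ 4) by nra.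
  assert (0.9437088 * (1 - h^2/2) <= cos x * cos h) by nra.
  assert (sin x * sin h <= 0.330778 * (h - h^3/6 + h^5/120)) by nra.
  assert (sin y * cos h <= 0.004259) by nra.
  assert (0.99999 * (h - h^3/6) <= cos y * sin h) by nra.
  assert (h * (0.334792 - 0.004259 + 0.99999 * (h - h^3/6))
    <= h * (sin z + - (sin y * cos h - cos y * sin h)))
    by (apply Rmult_le_compat_l; lra).
  nra.
Qed.

Lemma circle_before_first_cut (s : R) : 0 <= s <= 0.62993165702 ->
  2 - 2 * cos (2.3117 + 3 / 2 * s) <= (2.3117 - s / 2) ^ 2.
Proof.
  intros hs. pose proof PI_enclosure as hpi.
  (* Up to [s = 0.6234] the right-hand side is at least 4, the square of the diameter. Beyond it the
     two robots are nearly antipodal and cosine is expanded around [PI]. *)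
  destruct (Rle_lt_dec s 0.6234) as [h|h].
  - pose proof (COS_bound (2.3117 + 3 / 2 * s)). nra.
  - replace (2.3117 + 3 / 2 * s) with (PI + (2.3117 + 3 / 2 * s - PI)) by ring.
    remember (2.3117 + 3 / 2 * s - PI) as y eqn:Ey.
    rewrite Rtrigo_facts.cos_pi_plus.
    pose proof (cos_taylor_low y ltac:(lra)).
    assert (0.0110 <= y ^ 2 <= 0.0134) by nra.
    assert (0 <= y ^ 4 <= 0.0002) by nra.
    nra.
Qed.

Lemma circle_between_cuts (h : R) : 0 <= h <= 0.0367 ->
  2 - 2 * cos (5.216644270678 + 3 / 2 * h) <= (1.016710778916 - h / 2) ^ 2.
Proof.
  intros hh. pose proof PI_enclosure as hpi.
  remember (2 * PI - 5.216644270678) as x eqn:Ex.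
  assert (0.483155 <= cos x <= 0.483156) by enclose 1.0665410365.
  assert (0.875534 <= sin x <= 0.875535) by enclose 1.0665410365.
  replace (5.216644270678 + 3 / 2 * h) with (2 * PI - (x - 3 / 2 * h)) by lra.
  rewrite cos_2PI_minus, cos_minus.
  remember (3 / 2 * h) as k eqn:Ek.
  pose proof (cos_taylor_low k ltac:(lra)).
  pose proof (sin_taylor_low k ltac:(lra)).
  assert (0 <= k ^ 2 <= 0.06 * k) by nra.
  assert (0 <= k ^ 3 <= 0.06 * k ^ 2) by nra.
  assert (0.483155 * (1 - k^2/2) <= cos x * cos k) by nra.
  assert (0.875534 * (k - k^3/6) <= sin x * sin k) by nra.
  nra.
Qed.

Lemma circle_after_second_cut (h : R) : 0 <= h <= 0.00144 ->
  2 - 2 * cos (5.946058299624 + 3 / 2 * h) <= (0.335533370676 - h / 2) ^ 2.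
Proof.
  intros hh. pose proof PI_enclosure as hpi.
  remember (2 * PI - 5.946058299624) as x eqn:Ex.
  assert (0.9437088 <= cos x <= 0.943709) by enclose 0.3371270075.
  assert (0.330777 <= sin x <= 0.330778) by enclose 0.3371270075.
  replace (5.946058299624 + 3 / 2 * h) with (2 * PI - (x - 3 / 2 * h)) by lra.
  rewrite cos_2PI_minus, cos_minus.
  remember (3 / 2 * h) as k eqn:Ek.
  pose proof (cos_taylor_low k ltac:(lra)).
  pose proof (sin_taylor_low k ltac:(lra)).
  assert (0 <= k ^ 2 <= 0.003 * k) by nra.
  assert (0 <= k ^ 3 <= 0.003 * k ^ 2) by nra.
  assert (0.9437088 * (1 - k^2/2) <= cos x * cos k) by nra.
  assert (0.330777 * (k - k^3/6) <= sin x * sin k) by nra.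
  nra.
Qed.

Lemma circle_final (s : R) : 2.97374843355 <= s <= PI ->
  2 - 2 * cos (3 / 2 * s + 1.654640902113) <= (1.654640902113 - s / 2) ^ 2.
Proof.
  intros hs. pose proof PI_enclosure as hpi.
  replace (3 / 2 * s + 1.654640902113)
    with (2 * PI - (2 * PI - 3 / 2 * s - 1.654640902113)) by ring.
  rewrite cos_2PI_minus.
  remember (2 * PI - 3 / 2 * s - 1.654640902113) as x eqn:Ex.
  pose proof (cos_taylor_mid x ltac:(lra)) as Hc.
  (* [x] is the signed arc between the other robot and the exit at time [t0 + u], negative once that
     robot has passed the exit. The arc was [2 (PI - s)] at time [t0] and has shrunk by [u]. *)
  replace (1.654640902113 - s / 2) with (2 * (PI - s) - x) by lra.
  assert (-0.084 <= x <= 0.168) by lra.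
  assert (0 <= x ^ 2 <= 0.029) by nra.
  assert (0 <= x ^ 4) by nra.
  assert (x ^ 6 <= 0.029 * x ^ 4) by nra.
  (* Near [p2] the arc [x] slightly exceeds [u], so the [x ^ 4] term by which the squared chord
     falls short of [x ^ 2] is needed. From 2.98 on, [u ^ 2 - x ^ 2 = 4 (PI - s) (PI - s - x)] is
     nonnegative. *)
  destruct (Rle_lt_dec s 2.98) as [h|h].
  - assert (0.158 <= x) by lra. assert (0.0249 <= x ^ 2) by nra.
    assert (0.00062 <= x ^ 4) by nra. nra.
  - assert (0 <= (PI - s) * (PI - s - x)) by (apply Rmult_le_pos; lra).
    nra.
Qed.

(** * Continuity of the trajectories *)

Definition continuous_path (f : R -> point) : Prop :=
  continuity (fun t => fst (f t)) /\ continuity (fun t => snd (f t)).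

Lemma continuity_ext (f g : R -> R) :
  (forall x, f x = g x) -> continuity f -> continuity g.
Proof. intros h. now rewrite (functional_extensionality f g h). Qed.

(* The glued function is f (min t c) + g (max t c) - f c. *)
Lemma continuity_glue (c : R) (f g : R -> R) :
  continuity f -> continuity g -> f c = g c ->
  continuity (fun t => if Rle_dec t c then f t else g t).
Proof.
  intros hf hg hc.
  assert (hmin : continuity (fun t => (t + c - Rabs (t - c)) / 2)) by reg.
  assert (hmax : continuity (fun t => (t + c + Rabs (t - c)) / 2)) by reg.
  apply (continuity_ext (fun t => f ((t + c - Rabs (t - c)) / 2)
                   + g ((t + c + Rabs (t - c)) / 2) - f c)).
  - intros t. destruct (Rle_dec t c) as [h|h].
    + rewrite Rabs_left1 by lra.
      replace ((t + c - - (t - c)) / 2) with t by lra.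
      replace ((t + c + - (t - c)) / 2) with c by lra. lra.
    + rewrite Rabs_right by lra.
      replace ((t + c - (t - c)) / 2) with c by lra.
      replace ((t + c + (t - c)) / 2) with t by lra. lra.
  - apply continuity_minus; [|apply continuity_const; now intros ? ?].
    apply continuity_plus.
    + exact (continuity_comp _ f hmin hf).
    + exact (continuity_comp _ g hmax hg).
Qed.

Lemma continuous_path_glue (c : R) (f g : R -> point) :
  continuous_path f -> continuous_path g -> f c = g c ->
  continuous_path (fun t => if Rle_dec t c then f t else g t).
Proof.
  intros [hf1 hf2] [hg1 hg2] hc. split.
  - apply (continuity_ext (fun t => if Rle_dec t c then fst (f t) else fst (g t))).
    + intros t. now destruct (Rle_dec t c).
    + apply (continuity_glue c (fun t => fst (f t)) (fun t => fst (g t)));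
        [assumption | assumption | now rewrite hc].
  - apply (continuity_ext (fun t => if Rle_dec t c then snd (f t) else snd (g t))).
    + intros t. now destruct (Rle_dec t c).
    + apply (continuity_glue c (fun t => snd (f t)) (fun t => snd (g t)));
        [assumption | assumption | now rewrite hc].
Qed.

Lemma circle_path_continuous (r : robot) (c : R) :
  continuous_path (fun t => circle_pos r (t - c)).
Proof. split; unfold circle_pos; simpl; reg. Qed.

Lemma cut_path_continuous (r : robot) (p a d c : R) :
  continuous_path (fun t => cut_pos r p a d (t - c)).
Proof.
  (* With [u = t - c], the distance from the base of the cut is [d - |u - d|], which needs no case
     distinction. *)
  replace (fun t => cut_pos r p a d (t - c))
    with (fun t => (fst (circle_pos r p)
                    - side r * ((d - Rabs (t - c - d)) * cos a),
                    snd (circle_pos r p) + (d - Rabs (t - c - d)) * sin a)).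
  - split; simpl; reg.
  - extensionality t. unfold cut_pos. destruct (Rle_dec (t - c) d) as [h|h].
    + rewrite Rabs_left1 by lra. f_equal; ring.
    + rewrite Rabs_right by lra. f_equal; ring.
Qed.

(** This makes the switching times of [trajectory] nondecreasing, so that continuity only requires
    adjacent pieces to agree. *)
Definition ordered_params (A : params) : Prop :=
  0 <= p1 A <= p2 A /\ 0 <= d1 A /\ 0 <= d2 A.

Lemma cut_pos_base (r : robot) (p a d u : R) : 0 <= d -> u = 0 \/ u = 2 * d ->
  cut_pos r p a d u = circle_pos r p.
Proof.
  intros hd hu. unfold cut_pos, circle_pos; simpl.
  destruct (Rle_dec u d).
  - replace u with 0 by lra. f_equal; ring.
  - replace (2 * d - u) with 0 by lra. f_equal; ring.
Qed.

Lemma trajectory_continuous (A : params) (r : robot) :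
  ordered_params A -> continuous_path (trajectory A r).
Proof.
  intros (hp & hd1 & hd2). unfold trajectory.
  apply continuous_path_glue;
    [split; simpl; reg | |].
  2:{ destruct (Rle_dec 1 (1 + p1 A)); [|lra]. unfold circle_pos.
      replace (1 - 1) with 0 by ring. rewrite sin_0, cos_0. f_equal; ring. }
  apply continuous_path_glue; [apply circle_path_continuous | |].
  2:{ destruct (Rle_dec (1 + p1 A) (1 + p1 A + 2 * d1 A)); [|lra].
      rewrite cut_pos_base by lra. f_equal; ring. }
  apply continuous_path_glue; [apply cut_path_continuous | |].
  2:{ destruct (Rle_dec (1 + p1 A + 2 * d1 A) (1 + p2 A + 2 * d1 A)); [|lra].
      rewrite cut_pos_base by lra. f_equal; ring. }
  apply continuous_path_glue; [split; unfold circle_pos; simpl; reg | |].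
  2:{ destruct (Rle_dec (1 + p2 A + 2 * d1 A)
                        (1 + p2 A + 2 * d1 A + 2 * d2 A)); [|lra].
      rewrite cut_pos_base by lra. f_equal; ring. }
  apply continuous_path_glue;
    [apply cut_path_continuous | split; unfold circle_pos; simpl; reg |].
  rewrite cut_pos_base by lra. f_equal; ring.
Qed.

Lemma edist_continuous (E : point) (f : R -> point) :
  continuous_path f -> continuity (fun t => edist E (f t)).
Proof.
  intros [h1 h2] t. unfold edist, dist_euc.
  apply (continuity_pt_comp
    (fun t => Rsqr (fst E - fst (f t)) + Rsqr (snd E - snd (f t))) sqrt).
  - apply continuity_pt_plus;
      (apply (continuity_pt_comp _ Rsqr); [|apply derivable_continuous, derivable_Rsqr];
       apply continuity_pt_minus;
       [apply continuity_pt_const; now intros ? ? | apply h1 || apply h2]).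
  - apply continuity_pt_sqrt. apply Rplus_le_le_0_compat; apply Rle_0_sqr.
Qed.

Lemma continuity_shift (f : R -> R) (c : R) :
  continuity f -> continuity (fun u => f (c + u)).
Proof.
  intros hf. apply (continuity_comp (fun u => c + u) f); [reg | exact hf].
Qed.

(** * Existence of a least meeting delay *)

Lemma fixed_point_below (f : R -> R) (b : R) :
  continuity f -> 0 <= b -> 0 <= f 0 -> f b <= b ->
  exists u, 0 <= u <= b /\ f u = u.
Proof.
  intros hf hb h0 hfb.
  destruct (IVT_cor (fun u => f u - u) 0 b) as [u [hu eu]].
  - apply continuity_minus; [exact hf | apply derivable_continuous, derivable_id].
  - exact hb.
  - nra.
  - exists u. split; [exact hu | lra].
Qed.

(** The nonnegative fixed points form a nonempty closed set bounded below, so their infimum is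
    attained. *)
Lemma least_fixed_point (f : R -> R) (b : R) :
  continuity f -> 0 <= b -> 0 <= f 0 -> f b <= b ->
  exists u, is_least (fun u => 0 <= u /\ f u = u) u.
Proof.
  intros hf hb h0 hfb.
  destruct (fixed_point_below f b hf hb h0 hfb) as (v & hv & ev).
  (* [completeness] yields suprema, so the set is negated and [- m] is the infimum. *)
  destruct (completeness (fun x => 0 <= - x /\ f (- x) = - x)) as [m [hm1 hm2]].
  - exists 0. intros x [hx _]. lra.
  - exists (- v). rewrite Ropp_involutive. split; lra.
  - exists (- m).
    assert (hlow : forall x, 0 <= x /\ f x = x -> - m <= x).
    { intros x hx. enough (- x <= m) by lra. apply hm1. cbv beta.
      now rewrite Ropp_involutive. }
    assert (hm0 : 0 <= - m).
    { enough (m <= 0) by lra. apply hm2. intros x [hx _]. lra. }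
    split; [|exact hlow]. split; [exact hm0|].
    (* Otherwise continuity gives a radius [e] around [- m] without fixed points, and [m - e] would
       still bound the negated set from above. *)
    destruct (Req_dec (f (- m)) (- m)) as [e|ne]; [exact e|exfalso].
    assert (hg : continuity_pt (fun u => f u - u) (- m)).
    { apply continuity_pt_minus; [apply hf|].
      apply derivable_continuous_pt, derivable_pt_id. }
    destruct (continuous_neq_0 _ _ hg ltac:(lra)) as [e he].
    pose proof (cond_pos e).
    enough (m <= m - e) by lra.
    apply hm2. intros x [hx ex].
    destruct (Rle_lt_dec x (m - e)) as [h|h]; [exact h|exfalso].
    assert (- m <= - x) by (apply hlow; split; assumption).
    apply (he (- x - - m)); [apply Rabs_def1; lra|].
    replace (- m + (- x - - m)) with (- x) by ring. lra.
Qed.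

Lemma is_least_unique (S : R -> Prop) (x y : R) :
  is_least S x -> is_least S y -> x = y.
Proof. intros [hx lx] [hy ly]. apply Rle_antisym; auto. Qed.

(** * Distances and the evacuation time *)

Lemma edist_pos (P Q : point) : 0 <= edist P Q.
Proof. apply sqrt_pos. Qed.

Lemma edist_sqr (P Q : point) :
  edist P Q ^ 2 = (fst P - fst Q) ^ 2 + (snd P - snd Q) ^ 2.
Proof.
  unfold edist, dist_euc. rewrite <- Rsqr_pow2, Rsqr_sqrt.
  - unfold Rsqr. ring.
  - apply Rplus_le_le_0_compat; apply Rle_0_sqr.
Qed.

Lemma edist_refl (P : point) : edist P P = 0.
Proof. pose proof (edist_sqr P P). nra. Qed.

Lemma edist_eq_0 (P Q : point) : edist P Q = 0 -> Q = P.
Proof.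
  intros h. pose proof (edist_sqr P Q) as e. rewrite h in e.
  destruct P as [x y], Q as [x' y']; simpl in e.
  pose proof (Rle_0_sqr (x - x')) as hx. pose proof (Rle_0_sqr (y - y')) as hy.
  unfold Rsqr in hx, hy.
  assert (x - x' = 0) by (apply Rsqr_0_uniq; unfold Rsqr; lra).
  assert (y - y' = 0) by (apply Rsqr_0_uniq; unfold Rsqr; lra).
  f_equal; lra.
Qed.

Lemma edist_le (P Q : point) (u : R) :
  0 <= u -> (fst P - fst Q) ^ 2 + (snd P - snd Q) ^ 2 <= u ^ 2 -> edist P Q <= u.
Proof.
  intros hu h. rewrite <- edist_sqr in h. pose proof (edist_pos P Q). nra.
Qed.

Lemma along_1 (P Q : point) : along P Q 1 = Q.
Proof. destruct P, Q. unfold along; simpl. f_equal; ring. Qed.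

Lemma along_eq_end (P Q : point) (k : R) : along P Q k = Q -> P = Q \/ k = 1.
Proof.
  destruct P as [x y], Q as [x' y']. unfold along; simpl. intros e.
  injection e as e1 e2.
  destruct (Req_dec k 1) as [hk|hk]; [now right | left].
  assert (x' - x = 0).
  { apply (Rmult_eq_reg_l (1 - k)); lra. }
  assert (y' - y = 0).
  { apply (Rmult_eq_reg_l (1 - k)); lra. }
  f_equal; lra.
Qed.

(** The lower bound comes from the other robot. It cannot stand at [E] strictly before [t0 + t],
    since that would contradict the first discovery or give a smaller meeting delay; on the way back
    it reaches [E] only at the end of the segment. *)
Lemma evacuation_at_return (A : params) (E : point) (r : robot) (t0 t : R) :
  ordered_params A -> finds_exit A E r t0 -> meeting_delay A E r t0 t ->
  is_least (fun T => forall q, exists s, 0 <= s <= T /\ run A E r t0 t q s = E)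
    (t0 + 2 * t).
Proof.
  intros hA [hr [[ht0 _] hfirst]] [[ht hM] hleast].
  (* For [t = 0] the meeting point is [E] itself, so [along] returns [E] whatever the value of the
     division by [t]. *)
  assert (hM0 : t = 0 -> trajectory A (other r) (t0 + t) = E).
  { intros ->. now apply edist_eq_0. }
  assert (hback : along (trajectory A (other r) (t0 + t)) E
                        ((t0 + 2 * t - (t0 + t)) / t) = E).
  { destruct (Req_dec t 0) as [h|h].
    - rewrite (hM0 h). destruct E. unfold along; simpl. f_equal; ring.
    - replace ((t0 + 2 * t - (t0 + t)) / t) with 1 by (field; exact h).
      apply along_1. }
  split.
  - intros q. exists (t0 + 2 * t). split; [lra|].
    assert (hself : trajectory A r (t0 + 2 * t) = E \/ t0 < t0 + 2 * t).
    { destruct (Req_dec t 0) as [->|h]; [left | right; lra].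
      now replace (t0 + 2 * 0) with t0 by ring. }
    assert (hother : trajectory A (other r) (t0 + 2 * t) = E
                     \/ t0 + t < t0 + 2 * t).
    { destruct (Req_dec t 0) as [h|h]; [left | right; lra].
      rewrite <- (hM0 h). f_equal. lra. }
    unfold run.
    destruct q, r; simpl in *;
      repeat match goal with |- context [Rle_dec ?x ?y] => destruct (Rle_dec x y) end;
      try lra; try assumption; destruct hself, hother; try lra; assumption.
  - intros T hT. destruct (hT (other r)) as (s & hs & es).
    enough (t0 + 2 * t <= s) by lra.
    assert (es' : (if Rle_dec s (t0 + t) then trajectory A (other r) s
       else if Rle_dec s (t0 + 2 * t)
            then along (trajectory A (other r) (t0 + t)) E ((s - (t0 + t)) / t)
            else E) = E) by (destruct r; exact es).
    clear es. destruct (Rle_dec s (t0 + t)) as [h|h].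
    + assert (t0 <= s) by (apply hfirst; split; [lra | now exists (other r)]).
      destruct (fixed_point_below
        (fun u => edist E (trajectory A (other r) (t0 + u))) (s - t0))
        as (v & hv & ev).
      * apply (continuity_shift (fun t => edist E (trajectory A (other r) t))).
        now apply edist_continuous, trajectory_continuous.
      * lra.
      * apply edist_pos.
      * replace (t0 + (s - t0)) with s by ring. rewrite es', edist_refl. lra.
      (* The chain [t <= v <= s - t0 <= t] forces [s = t0 + t]; the distance to [E] is then 0, hence
         [t = 0]. *)
      * assert (t <= v) by (apply hleast; split; [lra | exact ev]).
        assert (es : s = t0 + t) by lra. subst s. rewrite es', edist_refl in hM.
        lra.
    + destruct (Rle_dec s (t0 + 2 * t)) as [h'|h']; [|lra].
      destruct (along_eq_end _ _ _ es') as [e|e].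
      * rewrite e, edist_refl in hM. lra.
      * assert (s - (t0 + t) = t); [|lra].
        apply (Rmult_eq_reg_r (/ t)).
        -- unfold Rdiv in e. rewrite e, Rinv_r; lra.
        -- apply Rinv_neq_0_compat. lra.
Qed.

(** * The discovery time *)

(** The tests are weak inequalities because the points at arc lengths [p1] and [p2] are reached
    before the cut that starts there. *)
Definition discovery (A : params) (s : R) : R :=
  if Rle_dec s (p1 A) then 1 + s
  else if Rle_dec s (p2 A) then 1 + s + 2 * d1 A
  else 1 + s + 2 * d1 A + 2 * d2 A.

Lemma trajectory_discovery (A : params) (r : robot) (s : R) :
  ordered_params A -> 0 <= s -> trajectory A r (discovery A s) = circle_pos r s.
Proof.
  intros (hp & hd1 & hd2) hs. unfold discovery, trajectory.
  repeat match goal with |- context [Rle_dec ?x ?y] => destruct (Rle_dec x y) end;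
    try lra; try (f_equal; ring).
  (* Only [s = 0] remains, where time 1 still belongs to the radial branch of [trajectory]. *)
  replace s with 0 by lra. unfold circle_pos. rewrite sin_0, cos_0. f_equal; ring.
Qed.

(** Second coordinates decide, as cosine is strictly decreasing on [[0, PI]]. This treats both
    robots at once. *)
Lemma circle_pos_first_visit (r r' : robot) (s x : R) :
  0 <= s <= PI -> 0 <= x -> circle_pos r x = circle_pos r' s -> s <= x.
Proof.
  intros hs hx e. injection e as _ e.
  destruct (Rle_lt_dec s x) as [h|h]; [exact h|].
  pose proof (cos_decreasing_1 x s ltac:(lra) ltac:(lra) ltac:(lra) ltac:(lra) h).
  lra.
Qed.

Lemma side_sqr (r : robot) : side r ^ 2 = 1.
Proof. destruct r; simpl; ring. Qed.

(* The chord from C_p in the cut direction has length 2 sin (p - a). *)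
Lemma cut_pos_on_circle (r : robot) (p a d u : R) :
  d < 2 * sin (p - a) -> 0 <= u <= 2 * d -> on_unit_circle (cut_pos r p a d u) ->
  cut_pos r p a d u = circle_pos r p.
Proof.
  intros hd hu. unfold cut_pos, on_unit_circle, circle_pos. simpl fst; simpl snd.
  set (l := if Rle_dec u d then u else 2 * d - u).
  assert (hl : 0 <= l <= d) by (unfold l; destruct (Rle_dec u d); lra).
  clearbody l. intros e.
  (* The squared norm of the point at distance [l] along the cut is [1 - l (2 sin (p - a) - l)]. *)
  assert (l * (2 * sin (p - a) - l) = 0).
  { rewrite sin_minus. pose proof (side_sqr r).
    pose proof (sin2_cos2 p) as hp. pose proof (sin2_cos2 a) as ha.
    unfold Rsqr in hp, ha.
    replace ((side r * sin p - side r * (l * cos a)) ^ 2)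
      with (side r ^ 2 * (sin p - l * cos a) ^ 2) in e by ring.
    rewrite side_sqr in e. nra. }
  assert (l = 0) as -> by nra. f_equal; ring.
Qed.

Lemma circle_pos_on_unit_circle (r : robot) (s : R) :
  on_unit_circle (circle_pos r s).
Proof.
  unfold on_unit_circle, circle_pos; simpl fst; simpl snd.
  rewrite Rpow_mult_distr, side_sqr. pose proof (sin2_cos2 s) as h.
  unfold Rsqr in h. lra.
Qed.

(** The way from the center meets the circle only at time 1, and a cut shorter than its chord meets
    it only at its base. Every visit to the exit therefore happens at an arc length of at least
    [s]. *)
Lemma discovery_first (A : params) (r r' : robot) (s t : R) :
  ordered_params A -> d1 A < 2 * sin (p1 A - alpha1 A) ->
  d2 A < 2 * sin (p2 A - alpha2 A) ->
  0 <= s <= PI -> 0 <= t -> trajectory A r t = circle_pos r' s ->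
  discovery A s <= t.
Proof.
  intros (hp & hd1 & hd2) hc1 hc2 hs ht e.
  pose proof (circle_pos_on_unit_circle r' s) as hE.
  unfold trajectory in e.
  destruct (Rle_dec t 1) as [b1|b1].
  { rewrite <- e in hE. unfold on_unit_circle in hE; simpl in hE.
    assert (t = 1) by nra. subst t. injection e as _ e.
    assert (s <= 0).
    { apply (circle_pos_first_visit r r'); try lra.
      unfold circle_pos. rewrite <- e, sin_0, cos_0. f_equal.
      pose proof (sin2_cos2 s) as h. rewrite <- e in h. unfold Rsqr in h.
      assert (sin s = 0) as -> by nra. ring. }
    unfold discovery. destruct (Rle_dec s (p1 A)); lra. }
  destruct (Rle_dec t (1 + p1 A)) as [b2|b2].
  { apply circle_pos_first_visit in e; [|lra|lra].
    unfold discovery. destruct (Rle_dec s (p1 A)); lra. }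
  destruct (Rle_dec t (1 + p1 A + 2 * d1 A)) as [b3|b3].
  { rewrite cut_pos_on_circle in e; [|lra|lra|congruence].
    apply circle_pos_first_visit in e; [|lra|lra].
    unfold discovery. destruct (Rle_dec s (p1 A)); lra. }
  destruct (Rle_dec t (1 + p2 A + 2 * d1 A)) as [b4|b4].
  { apply circle_pos_first_visit in e; [|lra|lra].
    unfold discovery. destruct (Rle_dec s (p1 A)); [lra|].
    destruct (Rle_dec s (p2 A)); lra. }
  destruct (Rle_dec t (1 + p2 A + 2 * d1 A + 2 * d2 A)) as [b5|b5].
  { rewrite cut_pos_on_circle in e; [|lra|lra|congruence].
    apply circle_pos_first_visit in e; [|lra|lra].
    unfold discovery. destruct (Rle_dec s (p1 A)); [lra|].
    destruct (Rle_dec s (p2 A)); lra. }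
  apply circle_pos_first_visit in e; [|lra|lra].
  unfold discovery. destruct (Rle_dec s (p1 A)); [lra|].
  destruct (Rle_dec s (p2 A)); lra.
Qed.

Lemma circle_pos_surjective (E : point) : on_unit_circle E ->
  exists r s, 0 <= s <= PI /\ E = circle_pos r s.
Proof.
  destruct E as [x y]. unfold on_unit_circle, circle_pos; simpl fst; simpl snd.
  intros e. assert (hy : -1 <= y <= 1) by nra.
  assert (hs : sin (acos y) = Rabs x).
  { rewrite sin_acos by exact hy. rewrite <- sqrt_Rsqr_abs. f_equal.
    unfold Rsqr. lra. }
  exists (if Rle_dec x 0 then Rob1 else Rob2), (acos y).
  split; [apply acos_bound|]. rewrite hs, cos_acos by exact hy.
  destruct (Rle_dec x 0); simpl; f_equal.
  - rewrite Rabs_left1; lra.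
  - rewrite Rabs_right; lra.
Qed.

(** * Distance from the exit to the other robot *)

(** The robots sweep in opposite directions from [I], so [s + x] is the central angle of the
    chord. *)
Lemma edist_circle_le (r : robot) (s x u : R) :
  0 <= u -> 2 - 2 * cos (s + x) <= u ^ 2 ->
  edist (circle_pos r s) (circle_pos (other r) x) <= u.
Proof.
  intros hu h. apply edist_le; [exact hu|].
  replace ((fst (circle_pos r s) - fst (circle_pos (other r) x)) ^ 2
           + (snd (circle_pos r s) - snd (circle_pos (other r) x)) ^ 2)
    with (2 - 2 * cos (s + x)); [exact h|].
  rewrite cos_plus. pose proof (sin2_cos2 s) as hs. pose proof (sin2_cos2 x) as hx.
  unfold Rsqr in hs, hx. destruct r; simpl; lra.
Qed.

(** [l] is a separate argument so that each use can supply it as an affine function of [s], outbound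
    or returning. *)
Lemma edist_cut_le (r : robot) (s p a d v l u : R) :
  0 <= u -> l = (if Rle_dec v d then v else 2 * d - v) ->
  2 - 2 * cos (p + s) + l ^ 2 - 2 * l * (sin (p - a) + sin (s + a)) <= u ^ 2 ->
  edist (circle_pos r s) (cut_pos (other r) p a d v) <= u.
Proof.
  intros hu hl h. apply edist_le; [exact hu|].
  unfold cut_pos. rewrite <- hl.
  match goal with |- ?X <= _ => replace X with
    (2 - 2 * cos (p + s) + l ^ 2 - 2 * l * (sin (p - a) + sin (s + a))) end;
    [exact h|].
  rewrite cos_plus, sin_minus, sin_plus.
  pose proof (sin2_cos2 s) as hs. pose proof (sin2_cos2 p) as hp.
  pose proof (sin2_cos2 a) as ha. unfold Rsqr in hs, hp, ha.
  assert (ha' : sin a * sin a = 1 - cos a * cos a) by lra.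
  assert (hl2 : l * l * (sin a * sin a) = l * l * (1 - cos a * cos a))
    by now rewrite ha'.
  destruct r; simpl; lra.
Qed.

(** * The given parameters *)

Lemma star_ordered : ordered_params star_params.
Proof. unfold ordered_params; simpl. lra. Qed.

(** The chords along the two cuts are longer than 1.87 and 0.66, well above the cut lengths of about
    0.49 and 0.17. *)
Lemma star_discovery_first (r r' : robot) (s t : R) :
  0 <= s <= PI -> 0 <= t -> trajectory star_params r t = circle_pos r' s ->
  discovery star_params s <= t.
Proof.
  pose proof PI_enclosure. apply discovery_first; [exact star_ordered | |]; simpl.
  - remember (2.62666582851 - 2 * PI / 9) as z eqn:Ez.
    assert (0.93669 <= sin z <= 0.93670) by enclose 1.9285341277. lra.
  - replace (2.97374843355 - 0.05523991 * PI)
      with (PI - (PI - 2.97374843355 + 0.05523991 * PI)) by ring.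
    rewrite sin_PI_x. remember (PI - 2.97374843355 + 0.05523991 * PI) as z eqn:Ez.
    assert (0.334792 <= sin z <= 0.334793) by enclose 0.3413855155. lra.
Qed.

Lemma star_discovery_bounds (s : R) : 0 <= s <= PI ->
  1 <= discovery star_params s <= 5.6234.
Proof.
  intros hs. pose proof PI_enclosure. unfold discovery; simpl.
  destruct (Rle_dec s 2.62666582851); [lra|].
  destruct (Rle_dec s 2.97374843355); lra.
Qed.

Lemma star_caught_in_time (r : robot) (s : R) : 0 <= s <= PI ->
  edist (circle_pos r s)
    (trajectory star_params (other r) ((5.6234 + discovery star_params s) / 2))
  <= (5.6234 - discovery star_params s) / 2.
Proof.
  intros hs. pose proof PI_enclosure as hpi.
  pose proof (star_discovery_bounds s hs) as hd. revert hd.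
  unfold trajectory, discovery; simpl.
  (* Of all combinations of the finder's phase at [t0] and the other robot's phase at [t0 + u], six
     are possible; they follow in order of increasing [s]. *)
  destruct (Rle_dec s 2.62666582851) as [a1|a1];
    [|destruct (Rle_dec s 2.97374843355) as [a2|a2]]; intros hd;
    repeat match goal with
    | |- context [Rle_dec ?x ?y] =>
        destruct (Rle_dec x y) as [?b|?b]; try (exfalso; lra)
    end.
  - apply edist_circle_le; [lra|].
    replace (s + ((5.6234 + (1 + s)) / 2 - 1)) with (2.3117 + 3 / 2 * s) by lra.
    replace ((5.6234 - (1 + s)) / 2) with (2.3117 - s / 2) by lra.
    apply circle_before_first_cut. lra.
  (* For this [s] the other robot is at the tip of its first cut at time [t0 + u]. *)
  - destruct (Rle_dec s 1.609955049594) as [c|c].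
    + apply edist_cut_le with (l := (s - 0.62993165702) / 2); [lra | |].
      { match goal with |- _ = if ?b then _ else _ => destruct b end; lra. }
      pose proof (first_cut_outbound (s - 0.62993165702) ltac:(lra)) as H.
      replace (0.62993165702 + (s - 0.62993165702)) with s in H by ring.
      replace ((5.6234 - (1 + s)) / 2)
        with (1.99673417149 - (s - 0.62993165702) / 2) by lra.
      exact H.
    + apply edist_cut_le with (l := (2.589978442168 - s) / 2); [lra | |].
      { match goal with |- _ = if ?b then _ else _ => destruct b end; lra. }
      pose proof (first_cut_return (2.589978442168 - s) ltac:(lra)) as H.
      replace (2.589978442168 - (2.589978442168 - s)) with s in H by ring.
      replace ((5.6234 - (1 + s)) / 2)
        with (1.016710778916 + (2.589978442168 - s) / 2) by lra.
      exact H.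
  - apply edist_circle_le; [lra|].
    pose proof (circle_between_cuts (s - 2.589978442168) ltac:(lra)) as H.
    replace (5.216644270678 + 3 / 2 * (s - 2.589978442168))
      with (s + ((5.6234 + (1 + s)) / 2 - 1 - 2 * 0.490011696287)) in H by lra.
    replace ((5.6234 - (1 + s)) / 2)
      with (1.016710778916 - (s - 2.589978442168) / 2) by lra.
    exact H.
  (* For this [s] the other robot is at the tip of its second cut at time [t0 + u]. *)
  - destruct (Rle_dec s 2.638215062874) as [c|c].
    + apply edist_cut_le with (l := 0.161272784418 + (s - 2.62666582851) / 2);
        [lra | |].
      { match goal with |- _ = if ?b then _ else _ => destruct b end; lra. }
      pose proof (second_cut_outbound (s - 2.62666582851) ltac:(lra)) as H.
      replace (2.62666582851 + (s - 2.62666582851)) with s in H by ring.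
      replace ((5.6234 - (1 + s + 2 * 0.490011696287)) / 2)
        with (0.508355389458 - (s - 2.62666582851) / 2) by lra.
      exact H.
    + apply edist_cut_le with (l := (2.972309866074 - s) / 2); [lra | |].
      { match goal with |- _ = if ?b then _ else _ => destruct b end; lra. }
      pose proof (second_cut_return (2.972309866074 - s) ltac:(lra)) as H.
      replace (2.972309866074 - (2.972309866074 - s)) with s in H by ring.
      replace ((5.6234 - (1 + s + 2 * 0.490011696287)) / 2)
        with (0.335533370676 + (2.972309866074 - s) / 2) by lra.
      exact H.
  - apply edist_circle_le; [lra|].
    pose proof (circle_after_second_cut (s - 2.972309866074) ltac:(lra)) as H.
    replace (5.946058299624 + 3 / 2 * (s - 2.972309866074))
      with (s + ((5.6234 + (1 + s + 2 * 0.490011696287)) / 2 - 1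
                 - 2 * 0.490011696287 - 2 * 0.1670474016)) in H by lra.
    replace ((5.6234 - (1 + s + 2 * 0.490011696287)) / 2)
      with (0.335533370676 - (s - 2.972309866074) / 2) by lra.
    exact H.
  - apply edist_circle_le; [lra|].
    pose proof (circle_final s ltac:(lra)) as H.
    replace (3 / 2 * s + 1.654640902113)
      with (s + ((5.6234 + (1 + s + 2 * 0.490011696287 + 2 * 0.1670474016)) / 2
                 - 1 - 2 * 0.490011696287 - 2 * 0.1670474016)) in H by lra.
    replace ((5.6234 - (1 + s + 2 * 0.490011696287 + 2 * 0.1670474016)) / 2)
      with (1.654640902113 - s / 2) by lra.
    exact H.
Qed.

Lemma star_meeting (r : robot) (s : R) : 0 <= s <= PI ->
  (exists t, meeting_delay star_params (circle_pos r s) r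
               (discovery star_params s) t) /\
  (forall t, meeting_delay star_params (circle_pos r s) r
               (discovery star_params s) t ->
     discovery star_params s + 2 * t <= 5.6234).
Proof.
  intros hs. pose proof (star_discovery_bounds s hs) as hd.
  pose proof (star_caught_in_time r s hs) as hc.
  set (t0 := discovery star_params s) in *.
  set (f := fun u => edist (circle_pos r s)
                       (trajectory star_params (other r) (t0 + u))).
  assert (hf : continuity f).
  { apply (continuity_shift
      (fun t => edist (circle_pos r s) (trajectory star_params (other r) t))).
    apply edist_continuous, trajectory_continuous, star_ordered. }
  assert (hb : f ((5.6234 - t0) / 2) <= (5.6234 - t0) / 2).
  { unfold f. replace (t0 + (5.6234 - t0) / 2) with ((5.6234 + t0) / 2) by lra.
    exact hc. }
  assert (h0 : 0 <= f 0) by apply edist_pos.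
  split.
  - exact (least_fixed_point f ((5.6234 - t0) / 2) hf ltac:(lra) h0 hb).
  - intros t [_ ht].
    destruct (fixed_point_below f ((5.6234 - t0) / 2) hf ltac:(lra) h0 hb)
      as (u & hu & eu).
    assert (t <= u) by (apply ht; split; [lra | exact eu]). lra.
Qed.

Theorem theorem3 (E : point) (hE : on_unit_circle E) :
  (exists T : R, evacuation_time star_params E T) /\
  (forall T : R, evacuation_time star_params E T -> T <= 5.6234).
Proof.
  destruct (circle_pos_surjective E hE) as (r0 & s & hs & eE).
  pose proof (star_discovery_bounds s hs) as hd.
  assert (hdisc : is_least (fun t => 0 <= t /\
    exists r, trajectory star_params r t = E) (discovery star_params s)).
  { split.
    - split; [lra|]. exists r0. rewrite eE.
      apply trajectory_discovery; [exact star_ordered | lra].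
    - intros t [ht [r er]]. rewrite eE in er.
      exact (star_discovery_first r r0 s t hs ht er). }
  split.
  - destruct (star_meeting r0 s hs) as [[t ht] _]. rewrite <- eE in ht.
    exists (discovery star_params s + 2 * t), r0, (discovery star_params s), t.
    assert (hfind : finds_exit star_params E r0 (discovery star_params s)).
    { split; [|exact hdisc]. rewrite eE.
      apply trajectory_discovery; [exact star_ordered | lra]. }
    split; [exact hfind | split; [exact ht|]].
    now apply evacuation_at_return; [exact star_ordered | |].
  - intros T (r & t0 & t & hfind & ht & hT).
    rewrite (is_least_unique _ _ _ hT
      (evacuation_at_return _ _ _ _ _ star_ordered hfind ht)).
    destruct hfind as [er hfirst].
    pose proof (is_least_unique _ _ _ hfirst hdisc) as e0. subst t0.
    (* The finder [r] may differ from [r0] when both robots reach [E] together, at [I] or [I']; so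
       [E] is rewritten as the position of [r]. *)
    rewrite trajectory_discovery in er by (exact star_ordered || lra).
    rewrite <- er in ht. exact (proj2 (star_meeting r s hs) t ht).
Qed.
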